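(* Let $f,g\in L_n^1\times\dotsm\times L_n^n$ be two systems on $\mathbb{K}^n$. For every $\pi\in S_n$, $\pi(\Phi(f))=\Phi(g)$ if and only if $\pi\cdot M_{l_{\Phi(f)}}=M_{l_{\Phi(g)}}$. In particular, $f$ is graph equivalent to $g$ if and only if there exists $\pi\in S_n$ such that $\pi\cdot M_{l_{\Phi(f)}}=M_{l_{\Phi(g)}}$.
   Context: Let $\mathbb{K}=\{0,1\}$, viewed as the field with two elements, and let $n\ge1$. For $1\le j\le n$, $L_n^j$ is the set of all functions $h:\mathbb{K}^n\to\mathbb{K}^n$ which are the identity on all coordinates except possibly the $j$-th, i.e. $h(x)=(x_1,\dots,x_{j-1},h_j(x),x_{j+1},\dots,x_n)$ with $h_j:\mathbb{K}^n\to\mathbb{K}$ arbitrary. $L_0^j\subset L_n^j$ is the subset of those $h$ for which $h_j(x)$ depends only on $x_j$. A system on $\mathbb{K}^n$ is an element $f=(f^1,\dots,f^n)$ of $L_n^1\times\dotsm\times L_n^n$. The graph $\Phi(f)$ is the simple graph on the vertex set $\{1,\dots,n\}$ defined as follows. Let $\widetilde F$ be the set of all $n$-tuples $(\widetilde{f^1},\dots,\widetilde{f^n})$ which are either equal to $f$ or arise from $f$ by replacing one of its entries $f^k$ (for some $k$) by an element of $L_0^k$. For $i\ne j$, $(i,j)$ is an edge of $\Phi(f)$ if and only if $\widetilde{f^i}\circ\widetilde{f^j}=\widetilde{f^j}\circ\widetilde{f^i}$ for all $(\widetilde{f^1},\dots,\widetilde{f^n})\in\widetilde F$. Two systems $f,g$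 are graph equivalent if the graphs $\Phi(f)$ and $\Phi(g)$ are isomorphic. For a simple graph $G$ on $\{1,\dots,n\}$, $M_{l_G}$ denotes the $n\times n$-matrix over $\mathbb{K}$ which is the adjacency matrix of the complement $\overline G$ of $G$ in the complete graph $K_n$: $(M_{l_G})_{ii}=0$, and for $i\neq j$, $(M_{l_G})_{ij}=1$ if $(i,j)$ is not an edge of $G$ and $0$ otherwise. (The linear system $l_G$ with this matrix is called the linearization of any system $f$ with $\Phi(f)=G$.) $S_n$ is the group of permutations of $\{1,\dots,n\}$. It acts on graphs on $\{1,\dots,n\}$ by permuting vertices: $(\pi(i),\pi(j))$ is an edge of $\pi(G)$ if and only if $(i,j)$ is an edge of $G$. It acts on $n\times n$-matrices by $(\pi\cdot M)_{ij}=M_{\pi^{-1}(i)\pi^{-1}(j)}$. *)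

(* Defs.v *)
From HB Require Import structures.
From mathcomp Require Import all_boot all_order all_algebra all_fingroup.

Set Implicit Arguments.
Unset Strict Implicit.
Unset Printing Implicit Defensive.

Import GRing.Theory.

Local Open Scope ring_scope.

Definition state (n : nat) := 'rV['F_2]_n.

Definition selfmap (n : nat) := {ffun state n -> state n}.

(* [locfun j] is the set L_n^j. *)
Definition locfun (n : nat) (j : 'I_n) : {set selfmap n} :=
  [set h : selfmap n |
    [forall x : state n, forall i : 'I_n, (i != j) ==> (h x 0 i == x 0 i)]].

(* [locfun0 j] is the set L_0^j: the new value of the j-th coordinate is a
   function of its old value only. *)
Definition locfun0 (n : nat) (j : 'I_n) : {set selfmap n} :=
  [set h in locfun j |
    [forall x : state n, forall y : state n,
      (x 0 j == y 0 j) ==> (h x 0 j == h y 0 j)]].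

Definition systems (n : nat) : {set {ffun 'I_n -> selfmap n}} :=
  [set f : {ffun 'I_n -> selfmap n} | [forall j, f j \in locfun j]].

Definition replace (n : nat) (f : {ffun 'I_n -> selfmap n}) (k : 'I_n)
    (h : selfmap n) : {ffun 'I_n -> selfmap n} :=
  [ffun i => if i == k then h else f i].

(* [variants f] is the set \widetilde F: f itself, and all tuples obtained
   from f by replacing one entry f^k by an element of L_0^k. *)
Definition variants (n : nat) (f : {ffun 'I_n -> selfmap n}) :
    {set {ffun 'I_n -> selfmap n}} :=
  [set t | (t == f) ||
    [exists k : 'I_n, exists h in locfun0 k, t == replace f k h]].

(* Both orientations of an edge belong to the edge set, and all conditions are
   boolean, so that Leibniz equality of graphs is equality of edge sets. *)
Definition simple_edges (n : nat) (E : {set 'I_n * 'I_n}) : bool :=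
  [forall i, (i, i) \notin E] &&
  [forall i, forall j, ((i, j) \in E) ==> ((j, i) \in E)].

Record sgraph (n : nat) := SGraph {
  edges :> {set 'I_n * 'I_n};
  edges_simple : simple_edges edges
}.

HB.instance Definition _ (n : nat) := [isSub for @edges n].

Lemma simple_edgesP (n : nat) (E : {set 'I_n * 'I_n}) :
  reflect ((forall i, (i, i) \notin E) /\
           (forall i j, (i, j) \in E -> (j, i) \in E))
          (simple_edges E).
Proof.
apply: (iffP andP) => -[E_irr E_sym]; split.
- exact/forallP.
- by move=> i j; move/forallP/(_ i)/forallP/(_ j)/implyP: E_sym; apply.
- exact/forallP.
- by apply/forallP=> i; apply/forallP=> j; apply/implyP/E_sym.
Qed.

Definition Phi_edges (n : nat) (f : {ffun 'I_n -> selfmap n}) :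
    {set 'I_n * 'I_n} :=
  [set p | (p.1 != p.2) &&
    [forall t in variants f, forall x : state n,
      t p.1 (t p.2 x) == t p.2 (t p.1 x)]].

Lemma Phi_simple (n : nat) (f : {ffun 'I_n -> selfmap n}) :
  simple_edges (Phi_edges f).
Proof.
apply/simple_edgesP; split=> [i | i j]; first by rewrite inE eqxx.
rewrite !inE /= eq_sym => /andP[-> /forall_inP comm_ij] /=.
apply/forall_inP=> t /comm_ij /forallP comm_t.
by apply/forallP=> x; rewrite eq_sym.
Qed.

Definition Phi (n : nat) (f : {ffun 'I_n -> selfmap n}) : sgraph n :=
  SGraph (Phi_simple f).

Definition graph_iso (n : nat) (G H : sgraph n) : Prop :=
  exists2 phi : 'I_n -> 'I_n, bijective phi &
    forall i j, ((i, j) \in edges G) = ((phi i, phi j) \in edges H).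

Definition graph_equiv (n : nat) (f g : {ffun 'I_n -> selfmap n}) : Prop :=
  graph_iso (Phi f) (Phi g).

Definition perm_edges (n : nat) (pi : 'S_n) (G : sgraph n) :
    {set 'I_n * 'I_n} :=
  [set (pi p.1, pi p.2) | p in edges G].

Lemma perm_edgesE (n : nat) (pi : 'S_n) (G : sgraph n) (i j : 'I_n) :
  ((pi i, pi j) \in perm_edges pi G) = ((i, j) \in edges G).
Proof.
apply/imsetP/idP => [[[a b] Gab [/perm_inj-> /perm_inj->]] // | Gij].
by exists (i, j).
Qed.

Lemma perm_simple (n : nat) (pi : 'S_n) (G : sgraph n) :
  simple_edges (perm_edges pi G).
Proof.
have /simple_edgesP[G_irr G_sym] := edges_simple G.
apply/simple_edgesP; split=> [i | i j].
  by rewrite -(permKV pi i) perm_edgesE.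
by rewrite -(permKV pi i) -(permKV pi j) !perm_edgesE; apply: G_sym.
Qed.

Definition perm_graph (n : nat) (pi : 'S_n) (G : sgraph n) : sgraph n :=
  SGraph (perm_simple pi G).

Definition compl_edges (n : nat) (G : sgraph n) : {set 'I_n * 'I_n} :=
  [set p | (p.1 != p.2) && (p \notin edges G)].

Lemma compl_simple (n : nat) (G : sgraph n) : simple_edges (compl_edges G).
Proof.
have /simple_edgesP[_ G_sym] := edges_simple G.
apply/simple_edgesP; split=> [i | i j]; first by rewrite inE eqxx.
by rewrite !inE /= eq_sym => /andP[-> /=]; apply/contra/G_sym.
Qed.

Definition compl_graph (n : nat) (G : sgraph n) : sgraph n :=
  SGraph (compl_simple G).

Definition adjmx (n : nat) (G : sgraph n) : 'M['F_2]_n :=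
  \matrix_(i, j) ((i, j) \in edges G)%:R.

(* [linmx G] is the matrix M_{l_G} of the linear system l_G. *)
Definition linmx (n : nat) (G : sgraph n) : 'M['F_2]_n :=
  adjmx (compl_graph G).

Lemma linmxE (n : nat) (G : sgraph n) (i j : 'I_n) :
  linmx G i j = if i == j then 0 else ((i, j) \notin edges G)%:R.
Proof. by rewrite mxE inE /=; case: eqP. Qed.

Definition perm_act_mx (n : nat) (pi : 'S_n) (M : 'M['F_2]_n) : 'M['F_2]_n :=
  \matrix_(i, j) M ((pi^-1)%g i) ((pi^-1)%g j).

(* Main.v *)
Require Import Defs.
From mathcomp Require Import all_boot all_order all_algebra all_fingroup.

(** Only the graphs [Phi f] and [Phi g] matter, not the systems they come from.
    The matrix [linmx G] is a faithful encoding of [G]: its off-diagonal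
    entries record which pairs are non-edges, and a simple graph carries no
    information on the diagonal ([linmx_inj]).  Complementation and adjacency
    matrices only relabel when the vertices are relabelled, so this encoding
    commutes with the two actions of the symmetric group ([linmx_perm_graph]).
    An equivariant injection reflects and preserves the relation of one object
    being the image of another under a given permutation, which is the first
    claim.  The second follows because isomorphisms between two graphs on the
    same finite vertex set are exactly the permutations carrying one to the
    other ([graph_isoP]). *)

Lemma loop_notin_edges (n : nat) (G : sgraph n) (i : 'I_n) :
  (i, i) \notin edges G.
Proof. by have /simple_edgesP[] := edges_simple G. Qed.

(** Distinct vertices are joined exactly when the matrix entry vanishes, as
    [0] and [1] differ in the two-element field; on the diagonal, where the
    entry is always [0], both graphs have no loop. *)
Lemma linmx_inj (n : nat) : injective (@linmx n).
Proof.
move=> G H eqGH; apply/val_inj/setP => -[i j] /=.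
have [<- | neq_ij] := eqVneq i j.
  by rewrite (negPf (loop_notin_edges _ G i)) (negPf (loop_notin_edges _ H i)).
have /matrixP/(_ i j) := eqGH.
by rewrite !linmxE (negPf neq_ij); do 2!case: (_ \in _).
Qed.

(** The inverse in the matrix action matches the direct image in the graph
    action: [(i, j)] is an edge of the relabelled graph when its preimage under
    [pi] is an edge of [G]. *)
Lemma linmx_perm_graph (n : nat) (pi : 'S_n) (G : sgraph n) :
  linmx (perm_graph pi G) = perm_act_mx pi (linmx G).
Proof.
apply/matrixP=> i j; rewrite [RHS]mxE !linmxE (inj_eq perm_inj).
by rewrite -[in LHS](permKV pi i) -[in LHS](permKV pi j) perm_edgesE !permKV.
Qed.

Lemma graph_isoP (n : nat) (G H : sgraph n) :
  graph_iso G H <-> exists pi : 'S_n, perm_graph pi G = H.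
Proof.
split=> [[phi /bij_inj phi_inj phiE] | [pi <-]]; last first.
  exists pi; first by exists (pi^-1)%g; [apply: permK | apply: permKV].
  by move=> i j; rewrite perm_edgesE.
exists (perm phi_inj); apply/val_inj/setP => -[i j] /=.
rewrite -(permKV (perm phi_inj) i) -(permKV (perm phi_inj) j).
by rewrite perm_edgesE phiE !permE.
Qed.

Theorem theorem4p6 (n : nat) (n_ge1 : (1 <= n)%N)
    (f g : {ffun 'I_n -> selfmap n})
    (f_sys : f \in systems n) (g_sys : g \in systems n) :
  (forall pi : 'S_n,
     perm_graph pi (Phi f) = Phi g <->
     perm_act_mx pi (linmx (Phi f)) = linmx (Phi g)) /\
  (graph_equiv f g <->
   exists pi : 'S_n, perm_act_mx pi (linmx (Phi f)) = linmx (Phi g)).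
Proof.
have perm_linmx (pi : 'S_n) : perm_graph pi (Phi f) = Phi g <->
    perm_act_mx pi (linmx (Phi f)) = linmx (Phi g).
  by rewrite -linmx_perm_graph; split=> [-> | /linmx_inj].
split=> //; apply: (iff_trans (graph_isoP _ _ _)).
by split=> -[pi /perm_linmx]; exists pi.
Qed.
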